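(* Let $f_t$ and $f'_t$ be two equivalent deformations of the $n$-BiHom-Lie algebra $(\mathfrak{g},[\cdot,\dots,\cdot]_{\mathfrak{g}},\alpha,\beta)$. Then the infinitesimal deformations $f_1$ and $f'_1$ belong to the same cohomology class in the cohomology group $H^2(\mathfrak{g},\mathfrak{g})$.
   Context: $\mathbb{K}$ is an algebraically closed field of characteristic $0$, all vector spaces are over $\mathbb{K}$, $n\ge 2$, and a hat denotes omission of an entry. An $n$-BiHom-Lie algebra $(\mathfrak{g},[\cdot,\dots,\cdot]_{\mathfrak{g}},\alpha,\beta)$ is a vector space $\mathfrak{g}$ with an $n$-linear operation $[\cdot,\dots,\cdot]_{\mathfrak{g}}:\mathfrak{g}^n\to\mathfrak{g}$ and linear maps $\alpha,\beta:\mathfrak{g}\to\mathfrak{g}$ such that for all elements of $\mathfrak g$: (1) $\alpha\circ\beta=\beta\circ\alpha$; (2) $\alpha([x_1,\dots,x_n]_{\mathfrak{g}})=[\alpha(x_1),\dots,\alpha(x_n)]_{\mathfrak{g}}$ and $\beta([x_1,\dots,x_n]_{\mathfrak{g}})=[\beta(x_1),\dots,\beta(x_n)]_{\mathfrak{g}}$; (3) (BiHom-skewsymmetry) $[\beta(x_1),\dots,\beta(x_{n-1}),\alpha(x_n)]_{\mathfrak{g}}$ changes sign when $x_k$ and $x_{k+1}$ are exchanged ($1\le k\le n-2$), and $[\beta(x_1),\dots,\beta(x_{n-1}),\alpha(x_n)]_{\mathfrak{g}}=-[\beta(x_1),\dots,\beta(x_{n-2}),\beta(x_n),\alpha(x_{n-1})]_{\mathfrak{g}}$;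 (4) ($n$-BiHom-Jacobi identity) $[\beta^2(x_1),\dots,\beta^2(x_{n-1}),[\beta(y_1),\dots,\beta(y_{n-1}),\alpha(y_n)]_{\mathfrak{g}}]_{\mathfrak{g}}=\sum_{k=1}^n(-1)^{n-k}[\beta^2(y_1),\dots,\widehat{\beta^2(y_k)},\dots,\beta^2(y_n),[\beta(x_1),\dots,\beta(x_{n-1}),\alpha(y_k)]_{\mathfrak{g}}]_{\mathfrak{g}}$. Cohomology. $C^1(\mathfrak{g},\mathfrak{g})$ is the space of linear maps $f:\mathfrak{g}\to\mathfrak{g}$ with $f\circ\alpha=\alpha\circ f$ and $f\circ\beta=\beta\circ f$. $C^2(\mathfrak{g},\mathfrak{g})$ is the space of $n$-linear maps $f:\mathfrak{g}^n\to\mathfrak{g}$ with $\alpha(f(x_1,\dots,x_n))=f(\alpha(x_1),\dots,\alpha(x_n))$, $\beta(f(x_1,\dots,x_n))=f(\beta(x_1),\dots,\beta(x_n))$, and which are BiHom-skewsymmetric (i.e. satisfy (3) with $f$ in place of the bracket). For $f\in C^1(\mathfrak{g},\mathfrak{g})$, $$\delta^1f(x_1,\dots,x_n)=-f([x_1,\dots,x_n]_{\mathfrak{g}})+\sum_{i=1}^n[x_1,\dots,f(x_i),\dots,x_n]_{\mathfrak{g}},$$ and for $f\in C^2(\mathfrak{g},\mathfrak{g})$, $$\delta^2f(x_1,\dots,x_{n-1},y_1,\dots,y_n)=[\beta^2(x_1),\dots,\beta^2(x_{n-1}),f(\beta(y_1),\dots,\beta(y_{n-1}),\alpha(y_n))]_{\mathfrak{g}}+f(\beta^2(x_1),\dots,\beta^2(x_{n-1}),[\beta(y_1),\dots,\beta(y_{n-1}),\alpha(y_n)]_{\mathfrak{g}})$$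 $$-\sum_{i=1}^n(-1)^{n-i}\Big([\beta^2(y_1),\dots,\widehat{\beta^2(y_i)},\dots,\beta^2(y_n),f(\beta(x_1),\dots,\beta(x_{n-1}),\alpha(y_i))]_{\mathfrak{g}}+f(\beta^2(y_1),\dots,\widehat{\beta^2(y_i)},\dots,\beta^2(y_n),[\beta(x_1),\dots,\beta(x_{n-1}),\alpha(y_i)]_{\mathfrak{g}})\Big).$$ Put $Z^2(\mathfrak{g},\mathfrak{g})=\{f\in C^2(\mathfrak{g},\mathfrak{g}):\delta^2f=0\}$, $B^2(\mathfrak{g},\mathfrak{g})=\delta^1C^1(\mathfrak{g},\mathfrak{g})\subseteq Z^2(\mathfrak{g},\mathfrak{g})$, and $H^2(\mathfrak{g},\mathfrak{g})=Z^2(\mathfrak{g},\mathfrak{g})/B^2(\mathfrak{g},\mathfrak{g})$. Deformations. A deformation of $(\mathfrak{g},[\cdot,\dots,\cdot]_{\mathfrak{g}},\alpha,\beta)$ is a $\mathbb{K}[[t]]$-$n$-linear map $f_t=\sum_{p\ge0}f_pt^p:\mathfrak{g}[[t]]\times\dots\times\mathfrak{g}[[t]]\to\mathfrak{g}[[t]]$, with $f_p:\mathfrak{g}^n\to\mathfrak{g}$ $n$-linear and $f_0=[\cdot,\dots,\cdot]_{\mathfrak{g}}$, such that $(\mathfrak{g}[[t]],f_t,\alpha,\beta)$ ($\alpha,\beta$ extended $\mathbb{K}[[t]]$-linearly) is an $n$-BiHom-Lie algebra, i.e. satisfies (1)-(4). The map $f_1$ is called the infinitesimal deformation; it lies in $Z^2(\mathfrak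 g,\mathfrak g)$. Two deformations $f_t,f'_t$ are equivalent if there is a formal automorphism $\Psi_t=\sum_{i\ge0}\psi_it^i$, with $\psi_i:\mathfrak{g}\to\mathfrak{g}$ linear, $\psi_0=\mathrm{id}_{\mathfrak{g}}$, $\psi_i\circ\alpha=\alpha\circ\psi_i$, $\psi_i\circ\beta=\beta\circ\psi_i$, such that $\Psi_t\circ f_t(x_1,\dots,x_n)=f'_t(\Psi_t(x_1),\dots,\Psi_t(x_n))$ for all $x_i$. *)

(* Defs.v *)
From HB Require Import structures.
From mathcomp Require Import all_boot all_order all_fingroup all_algebra.
From mathcomp Require Import boolp classical_sets functions.

Set Implicit Arguments.
Unset Strict Implicit.
Unset Printing Implicit Defensive.

Import GRing.Theory.

Local Open Scope classical_set_scope.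
Local Open Scope ring_scope.

(* [fps V] is V[[t]]: the sequence x stands for \sum_i x_i t^i.  Addition is   *)
(* pointwise; multiplication on K[[t]] and its action on V[[t]] are the Cauchy *)
(* products (and not the pointwise product of functions.v, hence the alias).   *)

Definition fps (V : Type) : Type := nat -> V.

HB.instance Definition _ (V : Type) := gen_eqMixin (fps V).
HB.instance Definition _ (V : Type) := gen_choiceMixin (fps V).

Section FpsZmodule.
Variable V : zmodType.
Implicit Types x y z : fps V.

Definition fps_zero : fps V := fun=> 0.
Definition fps_opp x : fps V := fun m => - x m.
Definition fps_add x y : fps V := fun m => x m + y m.

Lemma fps_addA : associative fps_add.
Proof. by move=> x y z; apply/funext => m; rewrite /fps_add addrA. Qed.

Lemma fps_addC : commutative fps_add.
Proof. by move=> x y; apply/funext => m; rewrite /fps_add addrC. Qed.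

Lemma fps_add0 : left_id fps_zero fps_add.
Proof. by move=> x; apply/funext => m; rewrite /fps_add add0r. Qed.

Lemma fps_addN : left_inverse fps_zero fps_opp fps_add.
Proof. by move=> x; apply/funext => m; rewrite /fps_add addNr. Qed.

HB.instance Definition _ :=
  GRing.isZmodule.Build (fps V) fps_addA fps_addC fps_add0 fps_addN.

End FpsZmodule.

Lemma fps_addE (V : zmodType) (x y : fps V) m : (x + y) m = x m + y m.
Proof. by []. Qed.

Definition fps_scale (R : comNzRingType) (V : lmodType R)
    (a : fps R) (v : fps V) : fps V :=
  fun m => \sum_(i < m.+1) a i *: v (m - i)%N.

Definition fps_mul (R : comNzRingType) (a b : fps R) : fps R :=
  fun m => \sum_(i < m.+1) a i * b (m - i)%N.

Definition fps_one (R : comNzRingType) : fps R := fun m => (m == 0%N)%:R.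

Lemma sum_triangle (V : nmodType) (F : nat -> nat -> V) m :
  \sum_(i < m.+1) \sum_(j < (m - i).+1) F i j =
  \sum_(k < m.+1) \sum_(i < k.+1) F i (k - i)%N.
Proof.
elim: m => [|m IHm]; first by rewrite !big_ord1.
rewrite [RHS]big_ord_recr /= -IHm [in LHS]big_ord_recr /= subnn big_ord1.
rewrite [in RHS](big_ord_recr m.+1) /= subnn addrA; congr (_ + _).
rewrite -big_split /=; apply: eq_bigr => i _.
have le_im : (i <= m)%N by rewrite -ltnS.
by rewrite subSn // big_ord_recr.
Qed.

Lemma fps_scaleA (R : comNzRingType) (V : lmodType R) (a b : fps R) (v : fps V) :
  fps_scale a (fps_scale b v) = fps_scale (fps_mul a b) v.
Proof.
apply/funext => m; rewrite /fps_scale /fps_mul.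
under eq_bigr do rewrite scaler_sumr.
rewrite (sum_triangle (fun i j => a i *: (b j *: v (m - i - j)%N))).
apply: eq_bigr => k _; rewrite scaler_suml; apply: eq_bigr => i _.
have le_ik : (i <= k)%N by rewrite -ltnS.
by rewrite scalerA -subnDA subnKC.
Qed.

Lemma fps_scale1 (R : comNzRingType) (V : lmodType R) :
  left_id (fps_one R) (@fps_scale R V).
Proof.
move=> v; apply/funext => m; rewrite /fps_scale big_ord_recl /= subn0 scale1r.
by rewrite big1 ?addr0 // => i _; rewrite scale0r.
Qed.

Lemma fps_scaleDr (R : comNzRingType) (V : lmodType R) :
  right_distributive (@fps_scale R V) +%R.
Proof.
move=> a u v; apply/funext => m; rewrite fps_addE /fps_scale -big_split.
by apply: eq_bigr => i _; rewrite fps_addE scalerDr.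
Qed.

Lemma fps_scaleDl (R : comNzRingType) (V : lmodType R) (v : fps V) :
  {morph (@fps_scale R V)^~ v : a b / a + b}.
Proof.
move=> a b; apply/funext => m; rewrite fps_addE /fps_scale -big_split.
by apply: eq_bigr => i _; rewrite fps_addE scalerDl.
Qed.

Lemma fps_mulC (R : comNzRingType) : commutative (@fps_mul R).
Proof.
move=> a b; apply/funext => m; rewrite /fps_mul (reindex_inj rev_ord_inj) /=.
apply: eq_bigr => i _; have le_im : (i <= m)%N by rewrite -ltnS.
by rewrite subSS subKn // mulrC.
Qed.

Lemma fps_one_neq0 (R : comNzRingType) : fps_one R != 0.
Proof.
by apply/eqP => /(congr1 (fun a : fps R => a 0%N)) /eqP; rewrite (negPf (oner_neq0 R)).
Qed.

HB.instance Definition _ (R : comNzRingType) :=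
  GRing.Zmodule_isComNzRing.Build (fps R)
    (@fps_scaleA R R^o) (@fps_mulC R) (@fps_scale1 R R^o)
    (fun a b c => @fps_scaleDl R R^o c a b) (@fps_one_neq0 R).

HB.instance Definition _ (R : comNzRingType) (V : lmodType R) :=
  GRing.Zmodule_isLmodule.Build (fps R) (fps V)
    (@fps_scaleA R V) (@fps_scale1 R V) (@fps_scaleDr R V) (@fps_scaleDl R V).

Definition nary (n : nat) (V : Type) : Type := ('I_n -> V) -> V.

Definition nlinear (R : comNzRingType) (V : lmodType R) n (mu : nary n V) : Prop :=
  forall (i : 'I_n) (x : 'I_n -> V) (a : R) (u v : V),
    mu [eta x with i |-> a *: u + v] =
    a *: mu [eta x with i |-> u] + mu [eta x with i |-> v].

(* The arguments (x_1, ..., x_{n-1}, z). *)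
Definition snoc (V : Type) n (x : 'I_n.-1 -> V) (z : V) : 'I_n -> V :=
  fun i => if insub (i : nat) is Some j then x j else z.

(* The arguments (beta x_1, ..., beta x_{n-1}, alpha x_n). *)
Definition twist (V : Type) n (alpha beta : V -> V) (x : 'I_n -> V) : 'I_n -> V :=
  fun i => if (i.+1 < n)%N then beta (x i) else alpha (x i).

(* Exchanging the last two entries before twisting gives                       *)
(* [beta x_1, ..., beta x_{n-2}, beta x_n, alpha x_{n-1}], so both clauses of  *)
(* BiHom-skewsymmetry have this one form.                                      *)
Definition bihom_skew (V : zmodType) n (alpha beta : V -> V) (mu : nary n V) : Prop :=
  forall (i j : 'I_n) (x : 'I_n -> V), j = i.+1 :> nat ->
    mu (twist alpha beta (x \o tperm i j)) = - mu (twist alpha beta x).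

(* [f (beta^2 x_1, ..., beta^2 x_{n-1},                                        *)
(*     h (beta y_1, ..., beta y_{n-1}, alpha y_n))]                            *)
Definition nested (V : Type) n (alpha beta : V -> V) (f h : nary n V)
    (x : 'I_n.-1 -> V) (y : 'I_n -> V) : V :=
  f (snoc (beta \o beta \o x) (h (twist alpha beta y))).

(* [f (beta^2 y_1, ..., omit beta^2 y_k, ..., beta^2 y_n,                      *)
(*     h (beta x_1, ..., beta x_{n-1}, alpha y_k))]                            *)
Definition nested_omit (V : Type) n (alpha beta : V -> V) (f h : nary n V)
    (x : 'I_n.-1 -> V) (y : 'I_n -> V) (k : 'I_n) : V :=
  nested alpha beta f h (y \o lift k) (snoc x (y k)).

Record nBiHomLie (R : comNzRingType) (V : lmodType R) n
    (br : nary n V) (alpha beta : V -> V) : Prop := NBiHomLie {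
  nbhl_nlinear : nlinear br;
  nbhl_linear_alpha : linear alpha;
  nbhl_linear_beta : linear beta;
  nbhl_comm : forall x, alpha (beta x) = beta (alpha x);
  nbhl_alpha : forall x, alpha (br x) = br (alpha \o x);
  nbhl_beta : forall x, beta (br x) = br (beta \o x);
  nbhl_skew : bihom_skew alpha beta br;
  (* k ranges over 0, ..., n-1, hence the exponent n - (k + 1). *)
  nbhl_jacobi : forall (x : 'I_n.-1 -> V) (y : 'I_n -> V),
    nested alpha beta br br x y =
    \sum_(k < n) (-1) ^+ (n - k.+1) *: nested_omit alpha beta br br x y k
}.

Section Cohomology.
Variables (R : comNzRingType) (V : lmodType R) (n : nat).
Variables (br : nary n V) (alpha beta : V -> V).

Definition C1 : set (V -> V) :=
  [set f | [/\ linear f, f \o alpha = alpha \o f & f \o beta = beta \o f]].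

Definition C2 : set (nary n V) :=
  [set f | [/\ nlinear f,
               forall x, alpha (f x) = f (alpha \o x),
               forall x, beta (f x) = f (beta \o x)
             & bihom_skew alpha beta f]].

Definition delta1 (f : V -> V) : nary n V :=
  fun x => - f (br x) + \sum_(i < n) br [eta x with i |-> f (x i)].

Definition delta2 (f : nary n V) (x : 'I_n.-1 -> V) (y : 'I_n -> V) : V :=
  nested alpha beta br f x y + nested alpha beta f br x y
  - \sum_(i < n) (-1) ^+ (n - i.+1) *:
      (nested_omit alpha beta br f x y i + nested_omit alpha beta f br x y i).

Definition Z2 : set (nary n V) :=
  [set f | C2 f /\ forall x y, delta2 f x y = 0].

Definition B2 : set (nary n V) := delta1 @` C1.

Definition cohomology_class (f : nary n V) : set (nary n V) :=
  [set (f \+ b) | b in B2].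

(* The quotient Z2 / B2, as the set of cosets of B2 by elements of Z2. *)
Definition H2 : set (set (nary n V)) := cohomology_class @` Z2.

End Cohomology.

(* The K[[t]]-linear extension of alpha. *)
Definition fps_map (V : Type) (alpha : V -> V) : fps V -> fps V :=
  fun x m => alpha (x m).

(* The map \sum_p f_p t^p on V[[t]]^n: the coefficient of t^m at (x_1,...,x_n) *)
(* is the sum of f_p (x_{1,d_1}, ..., x_{n,d_n}) over p + d_1 + ... + d_n = m. *)
Definition fps_nary (V : zmodType) n (f : nat -> nary n V) : nary n (fps V) :=
  fun x m => \sum_(p < m.+1)
    \sum_(d : {ffun 'I_n -> 'I_m.+1} | (p + \sum_(i < n) d i == m)%N)
      f p (fun i => x i (d i)).

(* The map \sum_i psi_i t^i on V[[t]]. *)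
Definition fps_endo (V : zmodType) (psi : nat -> V -> V) : fps V -> fps V :=
  fun x m => \sum_(i < m.+1) psi i (x (m - i)%N).

(* [f] is the sequence of coefficients f_p of the deformation. *)
Record deformation (K : comNzRingType) (g : lmodType K) n
    (br : nary n g) (alpha beta : g -> g) (f : nat -> nary n g) : Prop :=
  Deformation {
  def_nlinear : forall p, nlinear (f p);
  def_zero : f 0%N = br;
  def_nBiHomLie :
    @nBiHomLie (fps K) (fps g) n (fps_nary f) (fps_map alpha) (fps_map beta)
}.

Definition infinitesimal (V : Type) n (f : nat -> nary n V) : nary n V := f 1%N.

Record formal_automorphism (K : comNzRingType) (g : lmodType K)
    (alpha beta : g -> g) (psi : nat -> g -> g) : Prop := FormalAutomorphism {
  fa_linear : forall i, linear (psi i);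
  fa_zero : psi 0%N = id;
  fa_alpha : forall i, psi i \o alpha = alpha \o psi i;
  fa_beta : forall i, psi i \o beta = beta \o psi i
}.

Definition equivalent_deformations (K : comNzRingType) (g : lmodType K) n
    (alpha beta : g -> g) (f f' : nat -> nary n g) : Prop :=
  exists2 psi, formal_automorphism alpha beta psi &
    forall x : 'I_n -> fps g,
      fps_endo psi (fps_nary f x) = fps_nary f' (fps_endo psi \o x).

(* Main.v *)
(* Evaluate the identities satisfied by f_t on constant series and compare the *)
(* coefficients of t.  The axioms of an n-BiHom-Lie algebra for f_t then say   *)
(* that f_1 is a 2-cocycle, and the equivalence Psi_t gives                    *)
(*   f_1 (x) + psi_1 [x] = f'_1 (x) + \sum_i [x_1, ..., psi_1 x_i, ..., x_n],  *)
(* that is, f_1 - f'_1 = delta1 psi_1.                                         *)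

Require Import Defs.
From mathcomp Require Import all_boot all_order all_fingroup all_algebra.
From mathcomp Require Import boolp classical_sets functions.

Set Implicit Arguments.
Unset Strict Implicit.
Unset Printing Implicit Defensive.

Import GRing.Theory.

Local Open Scope ring_scope.

(** Taking coefficients of t linearises each identity around f_0 = [br]. By the Leibniz rule
    [fps_nary_coef1], the single factor t comes either from f_t or from exactly one argument; at
    constant series multilinearity kills the second kind of term. In this way the axioms for a
    deformation linearise to the cocycle conditions ([infinitesimal_Z2]), and the equivalence
    linearises to f_1 = f'_1 + delta1 psi_1 ([infinitesimal_equivalent]). Since psi_1 is linear and
    commutes with [alpha] and [beta], it is a 1-cochain, so f_1 lies in the coset of the cocycle
    f'_1. *)

Definition fps_const (V : zmodType) (v : V) : fps V :=
  fun m => if m is 0%N then v else 0.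

Lemma fps_nary_coef0 (V : zmodType) n (f : nat -> nary n V) (x : 'I_n -> fps V) :
  fps_nary f x 0%N = f 0%N (fun i => x i 0%N).
Proof.
rewrite /fps_nary big_ord1 (big_pred1 [ffun=> ord0]) => [|d].
  by congr (f _ _); apply/funext => i; rewrite ffunE.
rewrite add0n sum_nat_eq0 -[RHS]negbK; apply/forallP/negPn => [d0 | /eqP -> i].
  by apply/eqP/ffunP => i; rewrite ffunE ord1.
by rewrite ffunE.
Qed.

Lemma fps_nary_coef1 (V : zmodType) n (f : nat -> nary n V) (x : 'I_n -> fps V) :
  fps_nary f x 1%N = f 1%N (fun i => x i 0%N) +
    \sum_(i < n) f 0%N [eta (fun j => x j 0%N) with i |-> x i 1%N].
Proof.
(* The multidegrees of total degree 1, which index the terms with p = 0. *)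
pose unit_deg i : {ffun 'I_n -> 'I_2} := [ffun j => inord (j == i)].
have unit_degE i j : unit_deg i j = (j == i) :> nat.
  by rewrite ffunE inordK //; case: eqP.
have unit_deg_inj : injective unit_deg.
  move=> i j /(congr1 (fun d : {ffun 'I_n -> 'I_2} => d i : nat)).
  by rewrite !unit_degE eqxx; case: eqP.
rewrite /fps_nary big_ord_recl big_ord1 addrC; congr (_ + _).
  (* For p = 1 no degree is left for the arguments, so only the zero multidegree survives. *)
  rewrite (big_pred1 [ffun=> ord0]) => [|d].
    by congr (f _ _); apply/funext => i; rewrite ffunE.
  rewrite /= eqSS sum_nat_eq0 -[RHS]negbK.
  apply/forallP/negPn => [d0 | /eqP -> i]; last by rewrite ffunE.
  by apply/eqP/ffunP => i; apply/val_inj; rewrite ffunE; apply/eqP/d0.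
rewrite (eq_bigl (mem [set unit_deg i | i : 'I_n])) => [|d].
  rewrite big_imset /=; last by move=> i j _ _; apply: unit_deg_inj.
  apply: eq_bigr => i _; congr (f _ _); apply/funext => j /=.
  by rewrite unit_degE; case: eqP => [->|].
rewrite add0n /=; apply/idP/imsetP => [|[i _ ->]].
  case/sum_nat_eq1 => i [_ di dj]; exists i => //.
  apply/ffunP => j; apply/val_inj; rewrite /= unit_degE.
  by case: eqP => [->|/eqP ne_ji] //; apply: dj.
apply/sum_nat_eq1; exists i; split=> // [|j ne_ji _]; rewrite unit_degE.
  by rewrite eqxx.
by rewrite (negPf ne_ji).
Qed.

Lemma nlinear0 (R : comNzRingType) (V : lmodType R) n (mu : nary n V)
    (i : 'I_n) (x : 'I_n -> V) : nlinear mu -> x i = 0 -> mu x = 0.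
Proof.
move=> mu_lin xi0; have := mu_lin i x 1 0 0; rewrite !scale1r addr0.
have -> : ([eta x with i |-> 0] : 'I_n -> V) = x.
  by apply/funext => j /=; case: eqP => [->|].
by move/eqP; rewrite -subr_eq subrr => /eqP.
Qed.

Lemma fps_nary_const_coef1 (R : comNzRingType) (V : lmodType R) n
    (f : nat -> nary n V) (x : 'I_n -> V) :
  nlinear (f 0%N) -> fps_nary f (@fps_const V \o x) 1%N = f 1%N x.
Proof.
move=> f0_lin; rewrite fps_nary_coef1 big1 ?addr0 // => i _.
by rewrite (nlinear0 (i := i)) //= eqxx.
Qed.

Lemma snoc_comp (V W : Type) n (h : V -> W) (x : 'I_n.-1 -> V) z :
  h \o snoc x z = snoc (n := n) (h \o x) (h z).
Proof. by apply/funext => i; rewrite /snoc /=; case: insub. Qed.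

Lemma twist_comp (V W : Type) n (h : V -> W) (alpha beta : V -> V)
    (alpha' beta' : W -> W) (x : 'I_n -> V) :
    (forall v, alpha' (h v) = h (alpha v)) ->
    (forall v, beta' (h v) = h (beta v)) ->
  twist alpha' beta' (h \o x) = h \o twist alpha beta x.
Proof.
by move=> ha hb; apply/funext => i; rewrite /twist /=; case: ifP.
Qed.

Lemma fps_map_const (V : zmodType) (h : V -> V) v :
  h 0 = 0 -> fps_map h (fps_const v) = fps_const (h v).
Proof. by move=> h0; apply/funext => -[|m]. Qed.

(** In the Leibniz rule only the last argument is non-constant, so a single f_0 term remains. *)
Lemma fps_nary_snoc_coef1 (R : comNzRingType) (V : lmodType R) n
    (f : nat -> nary n V) (x : 'I_n.-1 -> V) (z : fps V) :
    (0 < n)%N -> nlinear (f 0%N) ->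
  fps_nary f (snoc (@fps_const V \o x) z) 1%N =
    f 1%N (snoc x (z 0%N)) + f 0%N (snoc x (z 1%N)).
Proof.
case: n => // n in f x * => _ f0_lin; rewrite fps_nary_coef1.
have snoc0 : (fun i => snoc (n := n.+1) (@fps_const V \o x) z i 0%N) = snoc x (z 0%N).
  by apply/funext => i; rewrite /snoc; case: insub.
rewrite snoc0; congr (_ + _).
have insub_max : insub (val (@ord_max n)) = None :> option 'I_n.
  by rewrite insubF //= ltnn.
rewrite (bigD1 ord_max) //= [X in _ + X]big1 ?addr0 => [|i ne_imax].
  congr (f _ _); apply/funext => i /=; case: eqP => [->|/eqP ne_imax].
    by rewrite /snoc insub_max.
  have lt_in : (i < n)%N by rewrite ltn_neqAle ne_imax -ltnS ltn_ord.
  by rewrite /snoc insubT.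
have lt_in : (i < n)%N by rewrite ltn_neqAle ne_imax -ltnS ltn_ord.
by rewrite (nlinear0 (i := i)) //= eqxx /snoc insubT.
Qed.

(** The two bracket terms of [delta2] arise here: the factor t comes from either the outer or the
    inner operation. *)
Lemma nested_coef1 (R : comNzRingType) (V : lmodType R) n
    (alpha beta : V -> V) (f : nat -> nary n V) (x : 'I_n.-1 -> V) (y : 'I_n -> V) :
    (0 < n)%N -> nlinear (f 0%N) -> alpha 0 = 0 -> beta 0 = 0 ->
  nested (fps_map alpha) (fps_map beta) (fps_nary f) (fps_nary f)
    (@fps_const V \o x) (@fps_const V \o y) 1%N =
  nested alpha beta (f 0%N) (f 1%N) x y + nested alpha beta (f 1%N) (f 0%N) x y.
Proof.
move=> n_gt0 f0_lin a0 b0; rewrite /nested addrC.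
rewrite (twist_comp (alpha := alpha) (beta := beta)); try by move=> v; apply: fps_map_const.
have -> : fps_map beta \o fps_map beta \o (@fps_const V \o x) =
    @fps_const V \o (beta \o beta \o x).
  by apply/funext => i /=; rewrite !fps_map_const.
by rewrite fps_nary_snoc_coef1 // fps_nary_coef0 fps_nary_const_coef1.
Qed.

(** Reducing to the parity of [k] turns the action of the sign into negation, which avoids the
    Cauchy product. *)
Lemma fps_signE (R : comNzRingType) (V : lmodType R) k (v : fps V) m :
  (((-1) ^+ k : fps R) *: v) m = (-1) ^+ k *: v m.
Proof. by rewrite -signr_odd -[in RHS]signr_odd !scaler_sign; case: odd. Qed.

Lemma fps_sumE (V : zmodType) (I : finType) (F : I -> fps V) m :
  (\sum_i F i) m = \sum_i F i m.
Proof. by apply: (big_morph (fun x : fps V => x m)). Qed.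

Lemma linear_map0 (R : pzRingType) (V : lmodType R) (h : V -> V) : linear h -> h 0 = 0.
Proof.
move=> h_lin; have := h_lin 1 0 0; rewrite !scale1r addr0 => /eqP.
by rewrite -subr_eq subrr => /eqP.
Qed.

Section Infinitesimal.
Variables (R : comNzRingType) (V : lmodType R) (n : nat).
Variables (br : nary n V) (alpha beta : V -> V).
Hypotheses (n_gt0 : (0 < n)%N) (alpha_lin : linear alpha) (beta_lin : linear beta).

(** Constant series are stable under the extended [alpha] and [beta], so each axiom can be read off
    at t. The Jacobi identity becomes [delta2] = 0 summand by summand. *)
Lemma infinitesimal_Z2 (f : nat -> nary n V) :
  deformation br alpha beta f -> Z2 br alpha beta (infinitesimal f).
Proof.
case=> f_lin f0E [_ _ _ _ f_alpha f_beta f_skew f_jacobi].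
have [a0 b0] := (linear_map0 alpha_lin, linear_map0 beta_lin).
have twist_const (x : 'I_n -> V) : twist (fps_map alpha) (fps_map beta)
    (@fps_const V \o x) = @fps_const V \o twist alpha beta x.
  by apply: twist_comp => v; rewrite fps_map_const.
have map_const h (x : 'I_n -> V) : h 0 = 0 ->
    fps_map h \o (@fps_const V \o x) = @fps_const V \o (h \o x).
  by move=> h0; apply/funext => i; apply: fps_map_const.
split; first split=> [|x|x|i j x jE].
- exact: f_lin.
- have := congr1 (@^~ 1%N) (f_alpha (@fps_const V \o x)).
  by rewrite map_const // /fps_map !fps_nary_const_coef1.
- have := congr1 (@^~ 1%N) (f_beta (@fps_const V \o x)).
  by rewrite map_const // /fps_map !fps_nary_const_coef1.
- have := congr1 (@^~ 1%N) (f_skew i j (@fps_const V \o x) jE).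
  rewrite /= !twist_const fps_nary_const_coef1 // => skew1; rewrite [LHS]skew1.
  by congr (- _); apply: fps_nary_const_coef1.
move=> x y; apply/eqP; rewrite /delta2 subr_eq0 /infinitesimal -f0E.
rewrite -nested_coef1 // f_jacobi fps_sumE; apply/eqP; apply: eq_bigr => k _.
rewrite fps_signE /nested_omit /=; congr (_ *: _); rewrite -nested_coef1 //.
by rewrite snoc_comp.
Qed.

Lemma infinitesimal_equivalent (f f' : nat -> nary n V) (psi : nat -> V -> V) x :
    f 0%N = br -> f' 0%N = br -> nlinear br -> formal_automorphism alpha beta psi ->
    (forall u : 'I_n -> fps V,
      fps_endo psi (fps_nary f u) = fps_nary f' (fps_endo psi \o u)) ->
  f 1%N x = f' 1%N x + delta1 br (psi 1%N) x.
Proof.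
move=> f0E f'0E br_lin [_ psi0 _ _] /(_ (@fps_const V \o x)).
move/(congr1 (@^~ 1%N)).
rewrite fps_nary_coef1 /fps_endo big_ord_recl big_ord1 /= psi0 /=.
rewrite fps_nary_const_coef1 ?f0E // fps_nary_coef0 f0E f'0E.
have -> : (fun i => \sum_(i0 < 1) psi i0 (fps_const (x i) (0 - i0)%N)) = x.
  by apply/funext => i; rewrite big_ord1 psi0.
(* The t-coefficient of Psi_t at a constant x_i is psi_0 0 + psi_1 x_i = psi_1 x_i. *)
under eq_bigr do rewrite big_ord_recl big_ord1 psi0 /= add0r.
by move=> eq1; rewrite /delta1 addrCA -eq1 addrC addrK.
Qed.

End Infinitesimal.

Theorem theorem5p7 (K : closedFieldType) (charK : [pchar K]%R =i pred0)
    (g : lmodType K) (n : nat) (n_ge2 : (2 <= n)%N)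
    (br : nary n g) (alpha beta : g -> g) (f f' : nat -> nary n g) :
  nBiHomLie br alpha beta ->
  deformation br alpha beta f ->
  deformation br alpha beta f' ->
  equivalent_deformations alpha beta f f' ->
  exists2 c : set (nary n g),
    H2 br alpha beta c & c (infinitesimal f) /\ c (infinitesimal f').
Proof.
move=> [br_lin alpha_lin beta_lin _ _ _ _ _] def_f def_f' [psi psi_aut psi_eq].
have n_gt0 : (0 < n)%N by apply: ltnW.
exists (cohomology_class br alpha beta (infinitesimal f')).
  by exists (infinitesimal f') => //; apply: infinitesimal_Z2 def_f'.
have B2_delta1 h : C1 alpha beta h -> B2 br alpha beta (delta1 br h) by exists h.
have [psi_lin psi0 psi_alpha psi_beta] := psi_aut; split.
  exists (delta1 br (psi 1%N)); first by apply: B2_delta1; split.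
  apply/funext => x; symmetry; apply: infinitesimal_equivalent psi_eq => //.
  - exact: def_zero def_f.
  - exact: def_zero def_f'.
(* The coset contains f'_1 itself through the coboundary of the zero cochain. *)
exists (delta1 br (fun=> 0)).
  apply: B2_delta1; split; first by move=> a u v; rewrite scaler0 addr0.
  - by apply/funext => v /=; rewrite (linear_map0 alpha_lin).
  - by apply/funext => v /=; rewrite (linear_map0 beta_lin).
apply/funext => x; rewrite /= /delta1 oppr0 add0r big1 ?addr0 // => i _.
by rewrite (nlinear0 (i := i)) //= eqxx.
Qed.
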